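(* Let $z>0$, let $\phi(x;z)=x^2-z^2$, and let $P_n=P_n(x;z)$ be the monic truncated Hermite polynomials with recurrence coefficients $\gamma_n=\gamma_n(z)$. For $n\in\mathbb{N}$ (that is, $n\ge 1$) define $$C_{n}(x;z)=\phi(x;z)+\gamma_{n}(z)+\gamma_{n+1}(z)-n-\frac{1}{2},$$ $$A_{n}(x;z)=\frac{\phi(x;z)}{2\gamma_{n}(z)C_{n}(x;z)},\qquad B_{n}(x;z)=\frac{n-2\gamma_{n}(z)}{2\gamma_{n}(z)C_{n}(x;z)}\,x,$$ and the operator $U_{n}=A_{n}(x;z)\,\partial_{x}-B_{n}(x;z)$. Then $$U_{n}P_{n}=P_{n-1},\qquad n\in\mathbb{N}.$$
   Context: For $z>0$ let $L[p]=\int_{-z}^{z}p(x)e^{-x^{2}}dx$, $p\in\mathbb{R}[x]$. The truncated Hermite polynomials $P_n(x;z)$, $n\ge0$, are the monic polynomials in $x$ with $\deg P_n=n$ and $L[P_kP_n]=h_n(z)\delta_{k,n}$, where $h_n(z)=L[P_n^2]>0$. They satisfy the three-term recurrence $xP_n(x;z)=P_{n+1}(x;z)+\gamma_n(z)P_{n-1}(x;z)$ with $P_{-1}=0$, $P_0=1$, where $\gamma_n(z)=h_n(z)/h_{n-1}(z)$ for $n\ge1$. The identity is an identity of rational functions of $x$. *)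

(* Defs.v *)
From HB Require Import structures.
From mathcomp Require Import all_boot all_order all_algebra.
From mathcomp Require Import all_classical all_reals all_analysis.
Set Implicit Arguments.
Unset Strict Implicit.
Unset Printing Implicit Defensive.
Import Order.TTheory GRing.Theory Num.Theory.
Local Open Scope ring_scope.

Definition hermite_functional (R : realType) (z : R) (p : {poly R}) : R :=
  \int[lebesgue_measure]_(x in `[- z, z]%classic) (p.[x] * expR (- x ^+ 2)).

(* For z > 0 the form (p, q) |-> hermite_functional z (p * q) is positive
   definite, so exactly one sequence P satisfies this predicate. *)
Definition truncated_hermite (R : realType) (z : R) (P : nat -> {poly R}) :
    Prop :=
  [/\ forall n, P n \is monic,
      forall n, size (P n) = n.+1
    & forall k n, k <> n -> hermite_functional z (P k * P n) = 0].

Section Lowering.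
Variables (R : realType) (z : R) (P : nat -> {poly R}).

Definition hermite_norm (n : nat) : R := hermite_functional z (P n ^+ 2).

(* Only meaningful for n >= 1. *)
Definition hermite_gamma (n : nat) : R := hermite_norm n / hermite_norm n.-1.

Definition hermite_phi : {poly R} := 'X^2 - (z ^+ 2)%:P.

(* Monic of degree 2, hence nonzero; for z > 0 and n >= 1, hermite_gamma n is
   also nonzero, so no division by zero occurs in loweringA and loweringB. *)
Definition loweringC (n : nat) : {poly R} :=
  hermite_phi + (hermite_gamma n + hermite_gamma n.+1 - n%:R - 1 / 2)%:P.

Definition loweringA (n : nat) : {fraction {poly R}} :=
  tofrac hermite_phi / tofrac ((2 * hermite_gamma n) *: loweringC n).

Definition loweringB (n : nat) : {fraction {poly R}} :=
  tofrac (n%:R - 2 * hermite_gamma n)%:P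
    / tofrac ((2 * hermite_gamma n) *: loweringC n) * tofrac 'X.

(* A_n d/dx - B_n on polynomials, with values in the rational functions. *)
Definition lowering (n : nat) (p : {poly R}) : {fraction {poly R}} :=
  loweringA n * tofrac p^`() - loweringB n * tofrac p.

End Lowering.

(* Main.v *)
(* Let D = phi P_n' - (n - 2 gamma_n) x P_n - 2 gamma_n C_n P_{n-1}; the claim is
   D = 0.  As P_n has no term of degree n - 1, D has degree less than n.  Since
   L[p' - 2 x p] = 0 whenever p vanishes at z and -z, L[D q] can be computed for
   deg q < n by taking p = phi P_n q: the recurrence makes only top coefficients
   contribute, and C_n is such that they cancel.  Hence L[D^2] = 0, and D = 0. *)
Require Import Defs.
From mathcomp Require Import all_boot all_order all_algebra.
From mathcomp Require Import all_classical all_reals all_analysis.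
From mathcomp Require Import ring.
Set Implicit Arguments.
Unset Strict Implicit.
Unset Printing Implicit Defensive.
Import Order.TTheory GRing.Theory Num.Theory.
Import numFieldTopology.Exports numFieldNormedType.Exports.
Local Open Scope ring_scope.
Local Open Scope classical_set_scope.

(** * The substitution of -x for x in a polynomial *)

Lemma comp_polyNX (R : comNzRingType) (p : {poly R}) :
  p \Po - 'X = \poly_(i < size p) ((-1) ^+ i * p`_i).
Proof.
rewrite comp_polyE poly_def; apply: eq_bigr => i _.
by rewrite (exprNn 'X) -!mul_polyC polyCM polyC_exp polyCN mulrCA mulrA.
Qed.

Lemma coef_comp_polyNX (R : comNzRingType) (p : {poly R}) i :
  (p \Po - 'X)`_i = (-1) ^+ i * p`_i.
Proof.
rewrite comp_polyNX coef_poly; case: ltnP => // pi.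
by rewrite nth_default // mulr0.
Qed.

(** * The functional [L]: integration by parts, definiteness, symmetry *)

Section Functional.
Variables (R : realType) (z : R).
Hypothesis hz : 0 < z.
Implicit Types (p q : {poly R}) (x : R).
Local Notation L := (hermite_functional z).
Local Notation mu := (@lebesgue_measure R).
Local Notation weighted p := (fun x : R => p.[x] * expR (- x ^+ 2)).

Lemma is_derive_weighted p x :
  is_derive x 1 (weighted p) (weighted (p^`() - 'X * p *+ 2) x).
Proof.
have de : is_derive x 1 (fun y : R => expR (- y ^+ 2))
    (expR (- x ^+ 2) * - (x *+ 2)).
  by apply: is_derive_eq; rewrite /GRing.scale /= !mulr1 -mulr2n.
apply: is_derive_eq.
rewrite /GRing.scale /= hornerD hornerN hornerMn hornerM hornerX.
move: p.[x] p^`().[x] (expR _) => a b c.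
ring.
Qed.

Lemma continuous_weighted p : continuous (weighted p).
Proof.
move=> x; apply/differentiable_continuous/derivable1_diffP.
by have [] := is_derive_weighted p x.
Qed.

Lemma integrable_weighted p : mu.-integrable `[- z, z] (EFin \o weighted p).
Proof.
apply: continuous_compact_integrable; first exact: segment_compact.
exact/continuous_subspaceT/continuous_weighted.
Qed.

Lemma hermite_functionalD p q : L (p + q) = L p + L q.
Proof.
rewrite /hermite_functional -RintegralD //; try exact: integrable_weighted.
by apply: eq_Rintegral => x _; rewrite hornerD mulrDl.
Qed.

Lemma hermite_functionalZ c p : L (c *: p) = c * L p.
Proof.
rewrite /hermite_functional -RintegralZl //; last exact: integrable_weighted.
by apply: eq_Rintegral => x _; rewrite hornerZ mulrA.
Qed.

(** The integrand on the left is the derivative of p(x) e^{-x^2}, and the weight takes the same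
    value at both endpoints. *)
Lemma hermite_functional_by_parts p :
  L (p^`() - 'X * p *+ 2) = (p.[z] - p.[- z]) * expR (- z ^+ 2).
Proof.
have dw x : derivable (weighted p) x 1 by have [] := is_derive_weighted p x.
rewrite /hermite_functional /Rintegral.
rewrite (@continuous_FTC2 _ _ (weighted p)).
- by rewrite -EFinB /= sqrrN mulrBl.
- by rewrite gtrN.
- exact/continuous_subspaceT/continuous_weighted.
- split; first by move=> x _; exact: dw.
  + exact/cvg_at_right_filter/continuous_weighted.
  + exact/cvg_at_left_filter/continuous_weighted.
- move=> x _; rewrite derive1E; have dwx := is_derive_weighted p x.
  by rewrite derive_val.
Qed.

(** A nonnegative integrand with zero integral vanishes almost everywhere. Finitely many roots would
    form a null set and make [-z, z] null as well, although its length is 2z > 0; so p has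
    infinitely many roots. *)
Lemma hermite_functional_sqr_eq0 p : L (p ^+ 2) = 0 -> p = 0.
Proof.
move=> Lp0; apply: contrapT => /eqP p0.
set D : set (measurableTypeR R) := `[- z, z].
have mD : measurable D by exact: measurable_itv.
have mw := measurable_int _ (integrable_weighted (p ^+ 2)).
have /(ae_eq_integral_abs mu mD mw)[N [mN N0 sub]] :
    (\int[mu]_(x in D) `|(EFin \o weighted (p ^+ 2)) x| = 0)%E.
  (* Finiteness is essential: [Rintegral] applies [fine], which also sends an infinite integral to
     0. *)
  have fin := integrable_fin_num (mu := mu) mD (integrable_weighted (p ^+ 2)).
  rewrite -[RHS]/((0 : R)%:E) -Lp0 /hermite_functional /Rintegral fineK //.
  apply: eq_integral => x _; rewrite /= ger0_norm // horner_exp.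
  by rewrite mulr_ge0 ?sqr_ge0 ?expR_ge0.
have pinf : infinite_set [set x | root p x].
  move=> /finite_set_countable cp.
  have mp : measurable ([set x | root p x] : set R).
    by apply: countable_measurable => // t; exact: measurable_set1.
  have : mu D = 0.
    apply/(negligibleP mu mD).
    apply: (@negligibleS _ _ _ _ (N `|` [set x | root p x])); last first.
      apply: negligibleU; first exact/negligibleP.
      exact/negligibleP/countable_lebesgue_measure0.
    move=> x zx; apply: contrapT => /not_orP[Nx px]; apply/Nx/sub => /=.
    move=> /(_ zx) [] /eqP; rewrite horner_exp mulf_eq0 sqrf_eq0.
    by rewrite (gt_eqF (expR_gt0 _)) orbF => /px.
  rewrite /D lebesgue_measure_itv /= lte_fin gtrN // => /eqP.
  by rewrite -EFinB eqe opprK gt_eqF // addr_gt0.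
have [B Bp] := infinite_set_fset (size p) pinf.
apply/negP; rewrite -ltnNge; apply: max_poly_roots => //.
  by apply/allP => x xB; exact: Bp.
exact: finmap.fset_uniq.
Qed.

(** Take q = p. Each polynomial identity below is proved by applying this test to the difference of
    its sides. *)
Lemma hermite_functional_mul_eq0 n p : (size p <= n)%N ->
  (forall q, (size q <= n)%N -> L (p * q) = 0) -> p = 0.
Proof. by move=> sp pq0; apply: hermite_functional_sqr_eq0; exact: pq0. Qed.

Lemma hermite_functional0 : L 0 = 0.
Proof. by rewrite -(scale0r 0) hermite_functionalZ mul0r. Qed.

Lemma hermite_functionalB p q : L (p - q) = L p - L q.
Proof. by rewrite -scaleN1r hermite_functionalD hermite_functionalZ mulN1r. Qed.

Lemma hermite_functionalMn p n : L (p *+ n) = L p *+ n.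
Proof. by rewrite -scaler_nat hermite_functionalZ mulr_natl. Qed.

(** An even power has equal values at z and -z, so integration by parts gives 2 L[x^(2k+1)] = 2k
    L[x^(2k-1)]; induct on k. *)
Lemma hermite_functional_odd k : L 'X^(k.*2.+1) = 0.
Proof.
elim: k => [|k IH].
  have := hermite_functional_by_parts 1.
  rewrite derivC mulr1 !hornerC subrr mul0r hermite_functionalB.
  rewrite hermite_functional0 hermite_functionalMn expr1 => /eqP.
  by rewrite sub0r oppr_eq0 mulrn_eq0 => /eqP.
have := hermite_functional_by_parts 'X^(k.+1.*2).
rewrite derivXn -exprS !hornerXn -mul2n exprM [(- z) ^+ _]exprM sqrrN.
rewrite subrr mul0r hermite_functionalB !hermite_functionalMn mul2n IH.
rewrite mul0rn sub0r => /eqP.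
by rewrite oppr_eq0 mulrn_eq0 => /eqP.
Qed.

Lemma hermite_functional_compNX p : L (p \Po - 'X) = L p.
Proof.
have Lsum (F : nat -> R) n :
    L (\sum_(i < n) F i *: 'X^i) = \sum_(i < n) F i * L 'X^i.
  rewrite (big_morph L hermite_functionalD hermite_functional0).
  by apply: eq_bigr => i _; rewrite hermite_functionalZ.
rewrite comp_polyNX -[in RHS](coefK p) !poly_def.
rewrite Lsum (Lsum (fun i => (-1) ^+ i * p`_i)); apply: eq_bigr => i _.
have [iodd|ieven] := boolP (odd i); last first.
  by rewrite -signr_odd (negbTE ieven) mul1r.
by rewrite -(odd_double_half i) iodd hermite_functional_odd !mulr0.
Qed.

End Functional.

(** * Orthogonality, parity, the recurrence and the lowering relation *)

Section Orthogonal.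
Variables (R : realType) (z : R) (P : nat -> {poly R}).
Hypotheses (hz : 0 < z) (hP : truncated_hermite z P).
Implicit Types (p q : {poly R}) (n k : nat).
Local Notation L := (hermite_functional z).
Local Notation h := (hermite_norm z P).
Local Notation gamma := (hermite_gamma z P).

Let coefPn n : (P n)`_n = 1.
Proof. by case: hP => /(_ n)/monicP + /(_ n) sP _; rewrite lead_coefE sP. Qed.

Let coefP_gt n k : (n < k)%N -> (P n)`_k = 0.
Proof. by case: hP => _ sP _ nk; rewrite nth_default // sP. Qed.

Lemma hermite_orthogonal_lt n q : (size q <= n)%N -> L (P n * q) = 0.
Proof.
(* The induction is on a bound m <= n for the size of q, with [P n] fixed; each step removes the top
   coefficient of q by a multiple of [P m]. *)
move: {1 3}n (leqnn n) => m; elim: m q => [|m IH] q mn sq.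
  move: sq; rewrite leqn0 size_poly_eq0 => /eqP ->.
  by rewrite mulr0 hermite_functional0.
have -> : P n * q = q`_m *: (P m * P n) + P n * (q - q`_m *: P m).
  by rewrite mulrBr -!mul_polyC; ring.
have L0 : L (P m * P n) = 0.
  by case: hP => _ _ -> // mE; rewrite mE ltnn in mn.
rewrite hermite_functionalD hermite_functionalZ L0 mulr0 add0r.
apply: IH; first exact: ltnW.
apply/leq_sizeP => j; rewrite leq_eqVlt coefB coefZ => /predU1P[<-|mj].
  by rewrite coefPn mulr1 subrr.
by rewrite coefP_gt // mulr0 subr0 nth_default // (leq_trans sq).
Qed.

Lemma hermite_orthogonal n q : (size q <= n.+1)%N -> L (P n * q) = q`_n * h n.
Proof.
move=> sq.
have -> : P n * q = q`_n *: P n ^+ 2 + P n * (q - q`_n *: P n).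
  by rewrite mulrBr -!mul_polyC; ring.
rewrite hermite_functionalD hermite_functionalZ hermite_orthogonal_lt ?addr0 //.
apply/leq_sizeP => j; rewrite leq_eqVlt coefB coefZ => /predU1P[<-|mj].
  by rewrite coefPn mulr1 subrr.
by rewrite coefP_gt // mulr0 subr0 nth_default // (leq_trans sq).
Qed.

Lemma hermite_norm_neq0 n : h n != 0.
Proof.
apply/eqP => /(hermite_functional_sqr_eq0 hz) P0.
by have := coefPn n; rewrite P0 coef0 => /eqP; rewrite eq_sym oner_eq0.
Qed.

Lemma hermite_gammaS n : h n.+1 = gamma n.+1 * h n.
Proof. by rewrite /hermite_gamma /= divfK // hermite_norm_neq0. Qed.

(** Since [L] is invariant under x -> -x, the polynomial (-1)^n P_n(-x) is again monic and
    orthogonal to all lower degrees, which determines it. *)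
Lemma hermite_parity n : P n \Po - 'X = (-1) ^+ n *: P n.
Proof.
suff : (-1) ^+ n *: (P n \Po - 'X) - P n = 0.
  by move/subr0_eq => {2}<-; rewrite scalerA -expr2 sqrr_sign scale1r.
apply: (hermite_functional_mul_eq0 (n := n) hz).
  apply/leq_sizeP => j; rewrite leq_eqVlt coefB coefZ coef_comp_polyNX.
  move=> /predU1P[<-|nj]; last by rewrite coefP_gt // !mulr0 subrr.
  by rewrite coefPn mulr1 -expr2 sqrr_sign subrr.
move=> q sq; rewrite mulrBl -scalerAl hermite_functionalB hermite_functionalZ.
rewrite (hermite_orthogonal_lt sq) subr0 -hermite_functional_compNX //.
rewrite comp_polyM.
rewrite -comp_polyA rmorphN /= comp_polyX opprK comp_polyXr.
rewrite hermite_orthogonal_lt ?mulr0 //.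
apply/leq_sizeP => j nj; rewrite coef_comp_polyNX nth_default ?mulr0 //.
exact: leq_trans nj.
Qed.

Lemma hermite_subleading n : (P n.+1)`_n = 0.
Proof.
have := congr1 (fun p : {poly R} => p`_n) (hermite_parity n.+1).
rewrite /= coef_comp_polyNX coefZ exprS mulN1r mulNr => /eqP.
by rewrite -subr_eq0 opprK -mulr2n mulrn_eq0 /= mulf_eq0 signr_eq0 => /eqP.
Qed.

(** Parity removes the [P n.+1] term. Against q of degree at most n both sides are multiples of q_n,
    and [gamma n.+1] is the ratio of norms that makes them agree. *)
Lemma hermite_recurrence n :
  'X * P n.+1 = P n.+2 + gamma n.+1 *: P n.
Proof.
apply/subr0_eq; apply: (hermite_functional_mul_eq0 (n := n.+1) hz).
  apply/leq_sizeP => j; rewrite !(coefB, coefD, coefZ) coefXM.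
  case: j => // j; rewrite leq_eqVlt /= => /predU1P[[<-]|nj].
    by rewrite !hermite_subleading coefP_gt // mulr0 addr0 subr0.
  rewrite (@coefP_gt n) ?(ltn_trans _ nj) // mulr0 addr0.
  move: nj; rewrite ltnS leq_eqVlt => /predU1P[<-|nj].
    by rewrite !coefPn subrr.
  by rewrite !coefP_gt // subrr.
move=> q sq.
have -> : ('X * P n.+1 - (P n.+2 + gamma n.+1 *: P n)) * q =
    P n.+1 * ('X * q) - P n.+2 * q - gamma n.+1 *: (P n * q).
  by rewrite -!mul_polyC; ring.
rewrite !hermite_functionalB hermite_functionalZ.
have sXq : (size ('X * q)%R <= n.+2)%N.
  by rewrite (leq_trans (size_polyMleq _ _)) // size_polyX.
have sq2 : (size q <= n.+2)%N := leqW sq.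
rewrite !hermite_orthogonal // ?(leqW sq2) //.
rewrite coefXM /= hermite_gammaS [q`_n.+2]nth_default //.
by ring.
Qed.

(** The claim with denominators cleared, at index [n.+1] so that no predecessor occurs. *)
Lemma hermite_lowering n :
  hermite_phi z * (P n.+1)^`() - (n.+1%:R - 2 * gamma n.+1)%:P * 'X * P n.+1 =
  ((2 * gamma n.+1) *: loweringC z P n.+1) * P n.
Proof.
rewrite /loweringC; set phi := hermite_phi z.
set c := n.+1%:R - 2 * _; set k := _ + _ - _ - _.
have coef_phi p j :
    (phi * p)`_j = (if (j < 2)%N then 0 else p`_(j - 2)) - z ^+ 2 * p`_j.
  by rewrite mulrBl coefB coefXnM coefCM.
have phi_z : phi.[z] = 0 by rewrite !hornerE subrr.
have phi_Nz : phi.[- z] = 0 by rewrite !hornerE sqrrN subrr.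
(* From here on only the coefficients of [phi * p] and the zeros of [phi] at z and -z matter. *)
clearbody phi.
have sub2 i : (i.+2 - 2 = i)%N by rewrite !subSS subn0.
apply/subr0_eq; apply: (hermite_functional_mul_eq0 (n := n.+1) hz).
  (* Coefficient n+1 vanishes by parity. Coefficient n+2 is (n+1) - c - 2 gamma_{n+1}, which is 0 by
     the choice of [c]. All higher ones exceed the degrees. *)
  apply/leq_sizeP => j; rewrite -scalerAl [(phi + _) * _]mulrDl -mulrA.
  rewrite !(coefB, coefD, coefZ, coefCM, coef_phi, coefXM, coef_deriv).
  case: j => // j; rewrite ltnS leq_eqVlt /= => /predU1P[<-|].
    rewrite hermite_subleading (coefP_gt (ltnSn n)) (coefP_gt (ltnSn n.+1)).
    (* For n = 0 the index is 1, below the shift by x^2; otherwise the subleading coefficient of P_n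
       also enters. *)
    case: n @c @k => [|n] c k.
      by rewrite /= !(mulr0, mul0rn, subr0, addr0).
    rewrite /= !sub2 !hermite_subleading.
    by rewrite !(mulr0, mul0rn, subr0, addr0).
  case: j => // j; rewrite ltnS leq_eqVlt sub2 /= => /predU1P[<-|nj].
    rewrite !coefPn (@coefP_gt n.+1 n.+3) // (@coefP_gt n n.+2) //.
    rewrite !(mulr0, mul0rn, subr0, addr0) /c; ring.
  have nj1 : (n.+1 < j.+1)%N := nj.
  rewrite (@coefP_gt n.+1 j.+1) // (@coefP_gt n.+1 j.+3) ?(leqW (leqW nj1)) //.
  rewrite (@coefP_gt n j) // (@coefP_gt n j.+2) ?(leqW (leqW nj)) //.
  by rewrite !(mulr0, mul0rn, subr0, addr0).
move=> q sq.
(* The terms 2 x phi P_n q (from parts) and - 2 gamma_n phi P_{n-1} q merge, by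
   the recurrence, into 2 phi P_{n+1} q (with n.+1 here in place of n). *)
have -> : (phi * (P n.+1)^`() - c%:P * 'X * P n.+1 -
    ((2 * gamma n.+1) *: (phi + k%:P)) * P n) * q =
    ((phi * (P n.+1 * q))^`() - 'X * (phi * (P n.+1 * q)) *+ 2)
    + 2%:R *: (P n.+2 * (phi * q)) - P n.+1 * (phi * q)^`()
    - c *: (P n.+1 * ('X * q)) - (2 * gamma n.+1 * k) *: (P n * q).
  have -> : P n.+2 = 'X * P n.+1 - gamma n.+1 *: P n.
    by rewrite hermite_recurrence addrK.
  rewrite !derivM -!mul_polyC !polyCM; ring.
have sphiq : (size (phi * q)%R <= n.+3)%N.
  apply/leq_sizeP => -[|[|j]] // nj; rewrite coef_phi /= sub2.
  by rewrite !nth_default ?mulr0 ?subr0 // (leq_trans sq) // ltnW // ltnW.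
have sdphiq : (size (phi * q)^`()%R <= n.+2)%N.
  by apply: leq_trans (size_poly _ _) _; case: (size _) sphiq.
have sXq : (size ('X * q)%R <= n.+2)%N.
  by rewrite (leq_trans (size_polyMleq _ _)) // size_polyX.
have lead_phiq : (phi * q)`_n.+2 = q`_n.
  by rewrite coef_phi sub2 /= [q`_n.+2]nth_default ?mulr0 ?subr0 // ltnW.
have := hermite_functional_by_parts hz (phi * (P n.+1 * q)).
rewrite !hornerM phi_z phi_Nz !mul0r subrr mul0r.
move: (_^`() - _ *+ 2) => ibp Libp.
rewrite !(hermite_functionalB, hermite_functionalD, hermite_functionalZ) Libp.
(* After division by q_n h_{n+1} what remains is 2 gamma_{n+2} - (n+2) - c - 2k, and [k] is the
   constant that makes it 0; the 1/2 in C_n comes from here. *)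
rewrite !hermite_orthogonal // coefXM coef_deriv lead_phiq /=.
rewrite -mulr_natr !hermite_gammaS /k /c; by field.
Qed.

End Orthogonal.

(** * Passage to rational functions *)

Theorem proposition18 (R : realType) (z : R) (hz : 0 < z)
    (P : nat -> {poly R}) (hP : truncated_hermite z P)
    (n : nat) (hn : (1 <= n)%N) :
  lowering z P n (P n) = tofrac (P n.-1).
Proof.
case: n hn => // n _; have := hermite_lowering hz hP n.
set d := _ *: loweringC _ _ _ => lowerP.
(* The gamma factor is a quotient of nonzero norms, and C_n has x^2-coefficient 1. *)
have d0 : tofrac d != 0.
  rewrite tofrac_eq0 scaler_eq0 mulf_eq0 pnatr_eq0 /=.
  rewrite mulf_eq0 invr_eq0 !(negbTE (hermite_norm_neq0 hz hP _)) /=.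
  apply/eqP => /(congr1 (fun p : {poly R} => p`_2)) /eqP.
  rewrite /loweringC /hermite_phi /= !(coefD, coefN, coefXn, coefC).
  by rewrite /= subr0 addr0 oner_eq0.
rewrite /lowering /loweringA /loweringB -/d.
(* Over the common denominator [d], the numerator becomes the right side of [lowerP]. *)
have -> : tofrac (P n) = tofrac (d * P n) / tofrac d.
  by rewrite tofracM mulrAC divff // mul1r.
rewrite -lowerP [in RHS]rmorphB [in RHS]mulrBl !rmorphM /=; congr (_ - _).
  by rewrite mulrAC.
by rewrite -!mulrA; congr (_ * _); rewrite mulrC -mulrA.
Qed.
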